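(* Let $R$ be a commutative ring with identity and $(A,f)$ an averaging $R$-algebra. Let $S=\{s_j:j\in J\}$ be a subset of $A$ which generates $(A,f)$ (i.e. the only averaging subalgebra of $(A,f)$ containing $S$ is $A$ itself), let $X=\{x_j:j\in J\}$ be a set, let $\eta:X\to S$ be the map with $\eta(x_j)=s_j$ for all $j\in J$, and let $\varphi:(F_X,f_X)\to(A,f)$ be the unique averaging homomorphism with $\varphi\circ i_X=\eta$, where $(F_X,f_X)$ is the free averaging $R$-algebra on $X$ and $i_X:X\to F_X$ is the inclusion (so $\varphi$ is surjective). Then the following are equivalent: (i) $\ker(f)=[A,A]_f$. (ii) $\varphi^{-1}(\ker(f))=\ker(f_X)+\ker(\varphi)$. (iii) $\ker(\varphi)\cap f_X(F_X)=f_X(\ker(\varphi))$.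
   Context: All rings and algebras are commutative with identity, and algebra homomorphisms preserve the identity. An averaging operator on an $R$-algebra $A$ is an $R$-module endomorphism $f:A\to A$ with $f(xf(y))=f(x)f(y)$ for all $x,y\in A$; $(A,f)$ is then an averaging $R$-algebra. An averaging subalgebra of $(A,f)$ is an $R$-subalgebra $A_1$ with $f(A_1)\subseteq A_1$. An averaging homomorphism $(A,f)\to(B,g)$ is an $R$-algebra homomorphism $\psi:A\to B$ with $\psi\circ f=g\circ\psi$. $[x,y]_f=xf(y)-yf(x)$, and $[A,A]_f$ is the $R$-submodule spanned by all $[x,y]_f$, $x,y\in A$. The free averaging $R$-algebra on $X$ is $(F_X,f_X)$: let $\Theta(X)$ be the set of monomials of $R[X]$ with coefficient $1_R$ (including $1_R$), let $Y=\{y_\theta:\theta\in\Theta(X)\}$ be a set of symbols, pairwise distinct for distinct $\theta$ and disjoint from $X$; then $F_X=R[X\cup Y]$ is the polynomial algebra and $f_X$ is the $R$-linear map with $f_X(uv)=y_uv$ for $u\in\Theta(X)$, $v\in R[Y]$. Its universal property: for any averaging $R$-algebra $(B,g)$ and map $\eta:X\to B$ there is a unique averaging homomorphism $\hat\varphi:(F_X,f_X)\to(B,g)$ with $\hat\varphi\circ i_X=\eta$. *)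

(* Defs.v *)
From HB Require Import structures.
From mathcomp Require Import all_boot all_order all_algebra.
From mathcomp Require Import finmap monalg classical_sets.

Set Implicit Arguments.
Unset Strict Implicit.
Unset Printing Implicit Defensive.

Import GRing.Theory.
Local Open Scope classical_set_scope.
Local Open Scope ring_scope.

Reserved Notation "a *:: x" (at level 40, left associativity).

(* Commutative R-algebras. In GRing.ComAlgebra the carrier is a nontrivial     *)
(* ring, whereas the zero ring and the zero algebra are allowed here;          *)
(* Hierarchy Builder refuses a join of GRing.ComPzRing and GRing.Lmodule       *)
(* declared after GRing.Lalgebra, so the scaling operation is a new one.       *)
HB.mixin Record ComPzRing_isPzAlgebra (R : comPzRingType) A
    of GRing.ComPzRing A := {
  ascale : R -> A -> A;
  ascaleA : forall a b x, ascale a (ascale b x) = ascale (a * b) x;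
  ascale1 : forall x, ascale 1 x = x;
  ascaleDr : forall a x y, ascale a (x + y) = ascale a x + ascale a y;
  ascaleDl : forall a b x, ascale (a + b) x = ascale a x + ascale b x;
  ascaleAl : forall a x y, ascale a (x * y) = ascale a x * y
}.

#[short(type="comPzAlgType")]
HB.structure Definition ComPzAlgebra (R : comPzRingType) :=
  { A of GRing.ComPzRing A & ComPzRing_isPzAlgebra R A }.

Notation "a *:: x" := (ascale a x) : ring_scope.

Section AlgebraTheory.
Context (R : comPzRingType).
Implicit Types (A B : comPzAlgType R) (a : R).

Lemma ascaleAr A a (x y : A) : a *:: (x * y) = x * (a *:: y).
Proof. by rewrite mulrC ascaleAl mulrC. Qed.

Lemma ascale0 A (x : A) : (0 : R) *:: x = 0.
Proof. by apply: (addrI ((0 : R) *:: x)); rewrite -ascaleDl !addr0. Qed.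

Lemma ascaler0 A a : a *:: (0 : A) = 0.
Proof. by apply: (addrI (a *:: 0)); rewrite -ascaleDr !addr0. Qed.

Lemma ascale_sumr A a (T : Type) (r : seq T) (F : T -> A) :
  a *:: (\sum_(i <- r) F i) = \sum_(i <- r) a *:: F i.
Proof. exact: (big_morph (ascale a) (ascaleDr a) (ascaler0 A a)). Qed.

Definition alg_linear A B (f : A -> B) : Prop :=
  forall a x y, f (a *:: x + y) = a *:: f x + f y.

Definition alg_scalable A B (f : A -> B) : Prop :=
  forall a x, f (a *:: x) = a *:: f x.

(* The R-submodule spanned by P. *)
Definition alg_span A (P : set A) : set A :=
  [set v | exists2 t : seq (R * A),
     (forall cx, cx \in t -> P cx.2) & v = \sum_(cx <- t) cx.1 *:: cx.2].

Section Linear.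
Context A B (f : A -> B) (f_lin : alg_linear f).

Lemma alg_linearD : {morph f : x y / x + y}.
Proof. by move=> x y; have := f_lin 1 x y; rewrite !ascale1. Qed.

Lemma alg_linear0 : f 0 = 0.
Proof. by apply: (addrI (f 0)); rewrite -alg_linearD !addr0. Qed.

Lemma alg_linearZ : alg_scalable f.
Proof. by move=> a x; have := f_lin a x 0; rewrite alg_linear0 !addr0. Qed.

Lemma alg_linear_sum (T : Type) (r : seq T) (F : T -> A) :
  f (\sum_(i <- r) F i) = \sum_(i <- r) f (F i).
Proof. exact: (big_morph f alg_linearD alg_linear0). Qed.
End Linear.
End AlgebraTheory.

Definition kernel (V W : nmodType) (f : V -> W) : set V := [set x | f x = 0].

Section Averaging.
Context (R : comPzRingType).
Implicit Types A B : comPzAlgType R.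

Definition averaging_operator A (f : A -> A) : Prop :=
  alg_linear f /\ forall x y, f (x * f y) = f x * f y.

Definition averaging_subalgebra A (f : A -> A) (A1 : set A) : Prop :=
  [/\ A1 1,
      forall (a : R) x y, A1 x -> A1 y -> A1 (a *:: x + y),
      forall x y, A1 x -> A1 y -> A1 (x * y)
    & forall x, A1 x -> A1 (f x)].

Definition averaging_generates A (f : A -> A) (S : set A) : Prop :=
  forall A1 : set A, averaging_subalgebra f A1 -> S `<=` A1 -> A1 = [set: A].

Definition averaging_morphism A B (f : A -> A) (g : B -> B)
    (psi : {rmorphism A -> B}) : Prop :=
  alg_scalable psi /\ psi \o f =1 g \o psi.

Definition avg_bracket A (f : A -> A) (x y : A) : A := x * f y - y * f x.

Definition avg_commutator A (f : A -> A) : set A :=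
  alg_span [set avg_bracket f x y | x in [set: A] & y in [set: A]].

End Averaging.

(* The monoid algebra R[K]; for K := {cmonom I}, the monomials in a set I of   *)
(* variables, it is the polynomial algebra R[I]. It is {malg R[K]}, whose ring *)
(* structure in monalg requires a nontrivial R; see monAlg_mulE.               *)
Definition monAlg (R : comPzRingType) (K : conomType) : Type := {malg R[K]}.

(* The operations are locked because unification unfolds them otherwise.       *)
HB.lock Definition pscale (R : comPzRingType) (K : conomType) (c : R)
    (g : {malg R[K]}) : {malg R[K]} :=
  \sum_(k <- msupp g) << c * g@_k *g k >>.

HB.lock Definition pmul (R : comPzRingType) (K : conomType)
    (g1 g2 : {malg R[K]}) : {malg R[K]} :=
  \sum_(k1 <- msupp g1) \sum_(k2 <- msupp g2) << g1@_k1 * g2@_k2 *g mmul k1 k2 >>.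

HB.lock Definition pmonom (R : comPzRingType) (K : conomType) (k : K) :
  monAlg R K := << 1 *g k >>.

Arguments pscale {R K} c g.
Arguments pmul {R K} g1 g2.
Arguments pmonom R {K} k.

Section MonAlg.
Context (R : comPzRingType) (M : conomType).
Local Notation T := {malg R[M]}.
Local Notation P := (monAlg R M).
Implicit Types (g : T) (k : M) (c : R).
Local Notation pscale := (@pscale R M).
Local Notation pmul := (@pmul R M).
Local Notation pmonom := (@pmonom R M).

Lemma pscaleE c g k : (pscale c g)@_k = c * g@_k.
Proof.
rewrite pscale.unlock (raddf_sum (mcoeff k)) /=.
rewrite [in RHS](monalgE g) (raddf_sum (mcoeff k)) /= mulr_sumr.
apply: eq_bigr=> i _.
by rewrite [LHS]mcoeffU [X in _ = _ * X]mcoeffU mulrnAr.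
Qed.

Lemma pscaleA c1 c2 g : pscale c1 (pscale c2 g) = pscale (c1 * c2) g.
Proof. by apply/malgP=> x; rewrite !pscaleE mulrA. Qed.

Lemma pscale1r g : pscale 1 g = g.
Proof. by apply/malgP=> k; rewrite !pscaleE mul1r. Qed.

Lemma pscaleDr c g1 g2 : pscale c (g1 + g2) = pscale c g1 + pscale c g2.
Proof.
by apply/malgP=> k; rewrite !(mcoeffD, pscaleE) mulrDr.
Qed.

Lemma pscaleDl c1 c2 g : pscale (c1 + c2) g = pscale c1 g + pscale c2 g.
Proof.
by apply/malgP=> k; rewrite !(mcoeffD, pscaleE) mulrDl.
Qed.

Definition pone : T := << 1 *g mone >>.

Lemma pmulw (d1 d2 : {fset M}) g1 g2 :
  (msupp g1 `<=` d1)%fset -> (msupp g2 `<=` d2)%fset ->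
  pmul g1 g2 =
  \sum_(k1 <- d1) \sum_(k2 <- d2) << g1@_k1 * g2@_k2 *g mmul k1 k2 >>.
Proof.
move=> le_d1 le_d2; rewrite pmul.unlock (big_fset_incl _ le_d1) /=.
  apply/eq_bigr=> k1 _; apply/big_fset_incl => // k _ /mcoeff_outdom ->.
  by rewrite mulr0 monalgU0.
move=> k _ /mcoeff_outdom g1k.
by rewrite big1 => // k' _; rewrite g1k mul0r monalgU0.
Qed.

Lemma pmulC : commutative pmul.
Proof.
move=> g1 g2; rewrite pmul.unlock exchange_big; apply: eq_bigr=> k2 _.
by apply: eq_bigr=> k1 _; rewrite mulrC mulmC.
Qed.

Lemma pmulDl : left_distributive pmul +%R.
Proof.
move=> g1 g2 g.
rewrite (@pmulw _ _ (g1 + g2) g (msuppD_le _ _) (fsubset_refl _)).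
rewrite (@pmulw _ _ g1 g (fsubsetUl _ (msupp g2)) (fsubset_refl _)).
rewrite (@pmulw _ _ g2 g (fsubsetUr (msupp g1) _) (fsubset_refl _)).
rewrite -big_split /=; apply/eq_bigr=> k1 _.
rewrite -big_split /=; apply/eq_bigr=> k2 _.
by rewrite mcoeffD mulrDl monalgUD.
Qed.

Lemma pmulDr : right_distributive pmul +%R.
Proof. by move=> g g1 g2; rewrite ![pmul g _]pmulC pmulDl. Qed.

Lemma pmul0 : left_zero 0 pmul.
Proof. by move=> g; rewrite pmul.unlock msupp0 big_seq_fset0. Qed.

Lemma pmulr0 : right_zero 0 pmul.
Proof. by move=> g; rewrite pmulC pmul0. Qed.

Lemma pmulUU c1 c2 k1 k2 :
  pmul << c1 *g k1 >> << c2 *g k2 >> = << c1 * c2 *g mmul k1 k2 >>.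
Proof. by rewrite (pmulw msuppU_le msuppU_le) !big_seq_fset1 !mcoeffUU. Qed.

Lemma pmul1 : left_id pone pmul.
Proof.
move=> g; rewrite (pmulw msuppU_le (fsubset_refl _)) big_seq_fset1.
rewrite [RHS](@monalgE _ R g); apply: eq_bigr => k _.
by rewrite mcoeffUU mul1r mul1m.
Qed.

Lemma pmul_suml (K : Type) (r : seq K) (F : K -> T) g :
  pmul (\sum_(i <- r) F i) g = \sum_(i <- r) pmul (F i) g.
Proof. exact: (big_morph (pmul^~ g) (fun _ _ => pmulDl _ _ _) (pmul0 g)). Qed.

Lemma pmul_sumr (K : Type) (r : seq K) (F : K -> T) g :
  pmul g (\sum_(i <- r) F i) = \sum_(i <- r) pmul g (F i).
Proof. exact: (big_morph (pmul g) (fun _ _ => pmulDr _ _ _) (pmulr0 g)). Qed.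

Lemma pmulA : associative pmul.
Proof.
move=> g1 g2 g3; rewrite [g1](@monalgE _ R) !pmul_suml; apply: eq_bigr => k1 _.
rewrite [g2](@monalgE _ R) pmul_suml !pmul_sumr pmul_suml.
apply: eq_bigr => k2 _.
rewrite [g3](@monalgE _ R) !pmul_sumr; apply: eq_bigr => k3 _.
by rewrite !pmulUU mulrA mulmA.
Qed.

HB.instance Definition _ := GRing.Zmodule.copy P {malg R[M]}.

HB.instance Definition _ := GRing.Zmodule_isComPzRing.Build P
  pmulA pmulC pmul1 pmulDl.

Lemma pscaleAl c g1 g2 : pscale c (pmul g1 g2) = pmul (pscale c g1) g2.
Proof.
have scE g : pscale c g = pmul << c *g mone >> g.
  rewrite pscale.unlock (pmulw msuppU_le (fsubset_refl _)) big_seq_fset1.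
  by apply: eq_bigr => k _; rewrite mcoeffUU mul1m.
by rewrite !scE; apply: pmulA.
Qed.

HB.instance Definition _ := ComPzRing_isPzAlgebra.Build R P
  pscaleA pscale1r pscaleDr pscaleDl pscaleAl.

Lemma pmonomM (k1 k2 : M) : pmonom (mmul k1 k2) = pmonom k1 * pmonom k2.
Proof.
have pmE : pmul (pmonom k1) (pmonom k2) = pmonom (mmul k1 k2).
  by rewrite pmonom.unlock pmulUU mulr1.
by symmetry; exact: pmE.
Qed.

Lemma pmonomE (g : P) : g = \sum_(k <- msupp g) g@_k *:: pmonom k.
Proof.
have pscaleU c k : << c *g k >> = pscale c (pmonom k).
  by apply/malgP=> k'; rewrite pmonom.unlock pscaleE !mcoeffU mulrnAr mulr1.
by rewrite [LHS](@monalgE _ R); apply: eq_bigr => k _; apply: pscaleU.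
Qed.

End MonAlg.

Lemma monAlg_mulE (R : comNzRingType) (K : conomType) :
  @GRing.mul (monAlg R K) = @GRing.mul {malg R[K]}.
Proof. by rewrite /GRing.mul /= pmul.unlock. Qed.

Section FreeAveraging.
Context (R : comPzRingType) (X : choiceType).

(* inl x is the variable x in X, and inr u the symbol y_u. *)
Definition avg_vars : choiceType := (X + {cmonom X})%type.

Definition freeAvg : comPzAlgType R := monAlg R {cmonom avg_vars}.

Definition freeAvg_var (x : X) : freeAvg := pmonom R (ucm (inl x : avg_vars)).

(* A monomial of R[X U Y] is uniquely u * v with u a monomial in X and v a     *)
(* monomial in Y; monom_X m is u, monom_Y m is v, and monom_op m is y_u * v.   *)
Definition monom_X (m : {cmonom avg_vars}) : {cmonom X} :=
  [cmonom m (inl x) | x in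
     [fset x | x in pmap (fun i => if i is inl x then Some x else None)
                         (finsupp m)]%fset]%M.

Definition monom_Y (m : {cmonom avg_vars}) : {cmonom avg_vars} :=
  [cmonom if i is inr _ then m i else 0 | i in finsupp m]%M.

Definition monom_op (m : {cmonom avg_vars}) : {cmonom avg_vars} :=
  mmul (ucm (inr (monom_X m) : avg_vars)) (monom_Y m).

(* The R-linear map with u * v |-> y_u * v.                                    *)
Definition freeAvg_op (p : freeAvg) : freeAvg :=
  \sum_(m <- msupp p) p@_m *:: pmonom R (monom_op m).

Lemma monom_XE m x : monom_X m x = m (inl x).
Proof.
rewrite cmE fsfun_fun; case: ifP => // /negP xm; apply/esym/eqP.
apply: contra_notT xm; rewrite cmE_neq0 => xm.
by rewrite !inE /= mem_pmap; apply/mapP; exists (inl x).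
Qed.

Lemma monom_YE m i : monom_Y m i = if i is inr _ then m i else 0%N.
Proof.
rewrite cmE fsfun_fun; case: i => [x|u]; case: ifP => // /negbT.
by rewrite -cmE_eq0 => /eqP ->.
Qed.

Lemma monom_opX m x : monom_op m (inl x) = 0%N.
Proof. by rewrite cmM cmU monom_YE. Qed.

Lemma monom_opM m n :
  monom_op (mmul m (monom_op n)) = mmul (monom_op m) (monom_op n).
Proof.
have X_opM : monom_X (mmul m (monom_op n)) = monom_X m.
  by apply/eqP/cmP => x; rewrite !monom_XE cmM monom_opX addn0.
have Y_opM : monom_Y (mmul m (monom_op n)) = mmul (monom_Y m) (monom_op n).
  apply/eqP/cmP => -[x|u]; rewrite [RHS]cmM !monom_YE ?monom_opX //.
  by rewrite cmM.
rewrite {1}/monom_op X_opM Y_opM; exact: mulmA.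
Qed.

Lemma freeAvg_opEw (d : {fset {cmonom avg_vars}}) (p : freeAvg) :
  (msupp p `<=` d)%fset ->
  freeAvg_op p = \sum_(m <- d) p@_m *:: pmonom R (monom_op m).
Proof.
move=> le_d; apply: big_fset_incl => // m _ /mcoeff_outdom ->.
by rewrite ascale0.
Qed.

Lemma freeAvg_op_is_linear : alg_linear freeAvg_op.
Proof.
move=> c p q; pose d := (msupp p `|` msupp q `|` msupp (c *:: p + q))%fset.
rewrite (@freeAvg_opEw d p) ?(@freeAvg_opEw d q) ?(@freeAvg_opEw d (c *:: p + q)).
- rewrite ascale_sumr -big_split /=; apply: eq_bigr => m _.
  by rewrite mcoeffD pscaleE ascaleDl ascaleA.
- by rewrite fsubsetUr.
- by rewrite /d -fsetUA fsetUCA fsubsetUl.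
- by rewrite /d -fsetUA fsubsetUl.
Qed.

Lemma freeAvg_op_monom m : freeAvg_op (pmonom R m) = pmonom R (monom_op m).
Proof.
by rewrite [in LHS]pmonom.unlock (freeAvg_opEw msuppU_le) big_seq_fset1 mcoeffUU ascale1.
Qed.

Lemma freeAvg_op_avg : averaging_operator freeAvg_op.
Proof.
have lin := freeAvg_op_is_linear; split; first exact: lin.
move=> x y.
have step m n : freeAvg_op (pmonom R m * freeAvg_op (pmonom R n)) =
    freeAvg_op (pmonom R m) * freeAvg_op (pmonom R n).
  by rewrite (freeAvg_op_monom n) -pmonomM !freeAvg_op_monom monom_opM pmonomM.
have stepy m : freeAvg_op (pmonom R m * freeAvg_op y) =
    freeAvg_op (pmonom R m) * freeAvg_op y.
  rewrite (pmonomE y) (alg_linear_sum lin) !mulr_sumr (alg_linear_sum lin).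
  apply: eq_bigr => n _.
  by rewrite (alg_linearZ lin) -!ascaleAr (alg_linearZ lin) step.
rewrite (pmonomE x) (alg_linear_sum lin) !mulr_suml (alg_linear_sum lin).
apply: eq_bigr => m _.
by rewrite (alg_linearZ lin) -!ascaleAl (alg_linearZ lin) stepy.
Qed.

End FreeAveraging.

(* Main.v *)
(** If [f_X(m) = f_X(m')] for distinct monomials [m = u v] and [m' = u' v'],
    then [u <> u'], [v = y_u' w] and [v' = y_u w], so that
    [m - m' = u f_X(u' w) - u' w f_X(u)] is a bracket.  Such differences span
    the kernel of [f_X], which is therefore the commutator submodule of the
    free algebra; the equivalences follow by pulling elements back along the
    surjection [phi]. *)

Require Import Defs.
From HB Require Import structures.
From mathcomp Require Import all_boot all_order all_algebra.
From mathcomp Require Import finmap monalg classical_sets.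

Import GRing.Theory.

Local Open Scope classical_set_scope.
Local Open Scope ring_scope.

Section Span.
Context {R : comPzRingType} {A B : comPzAlgType R}.
Implicit Types P : set A.

Lemma alg_span_sum P (T : eqType) (r : seq T) (c : T -> R) (F : T -> A) :
  (forall i, P (F i)) -> alg_span P (\sum_(i <- r) c i *:: F i).
Proof.
move=> PF; exists [seq (c i, F i) | i <- r]; last by rewrite big_map.
by move=> cx /mapP[i _ ->] /=.
Qed.

Lemma alg_span_image (psi : A -> B) P (Q : set B) (x : A) :
  alg_linear psi -> (forall y, P y -> Q (psi y)) ->
  alg_span P x -> alg_span Q (psi x).
Proof.
move=> psi_lin PQ [t tP ->]; exists [seq (cx.1, psi cx.2) | cx <- t].
  by move=> _ /mapP[cx cxt ->]; apply: PQ; apply: tP.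
rewrite big_map (alg_linear_sum psi_lin); apply: eq_bigr => cx _.
exact: alg_linearZ.
Qed.

(** Induction on the list of terms representing [y]: each term is lifted on its own and linearity of
    [psi] recombines the lifts. *)
Lemma alg_span_lift (psi : A -> B) P (Q : set B) (y : B) :
  alg_linear psi -> (forall z, Q z -> exists2 x, P x & psi x = z) ->
  alg_span Q y -> exists2 x, alg_span P x & psi x = y.
Proof.
move=> psi_lin QP [t tQ ->]; elim: t tQ => [|[c z] t IHt] tQ.
  by exists 0; [exists [::]; rewrite ?big_nil | rewrite big_nil (alg_linear0 psi_lin)].
have [|_ [r rP ->] psi_r] := IHt; first by move=> d dt; apply: tQ; rewrite inE dt orbT.
have [|x Px psi_x] := QP z; first by apply: (tQ (c, z)); rewrite inE eqxx.
exists (c *:: x + \sum_(d <- r) d.1 *:: d.2); last first.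
  by rewrite psi_lin psi_x psi_r big_cons.
exists ((c, x) :: r); last by rewrite big_cons.
by move=> d; rewrite inE => /predU1P[-> //|]; apply: rP.
Qed.

End Span.

Section AveragingOperator.
Context {R : comPzRingType} {A : comPzAlgType R} {f : A -> A}.
Hypothesis f_avg : averaging_operator f.

(** The averaging identity turns [f (x * f y)] into [f x * f y] and [f (y * f x)] into [f y * f x],
    which agree by commutativity. *)
Lemma averaging_bracket (x y : A) : f (avg_bracket f x y) = 0.
Proof.
have [f_lin f_op] := f_avg.
apply: (addIr (f (y * f x))); rewrite -(alg_linearD f_lin) /avg_bracket subrK.
by rewrite add0r !f_op mulrC.
Qed.

Lemma avg_commutator_sub_kernel : avg_commutator f `<=` kernel f.
Proof.
have [f_lin _] := f_avg => _ [t tP ->]; rewrite /kernel /= (alg_linear_sum f_lin).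
rewrite big_seq big1 // => cx /tP[x _ [y _ <-]].
by rewrite (alg_linearZ f_lin) averaging_bracket ascaler0.
Qed.

End AveragingOperator.

Section AveragingMorphism.
Context {R : comPzRingType} {A B : comPzAlgType R} {f : A -> A} {g : B -> B}.
Context {psi : {rmorphism A -> B}}.
Hypothesis psi_avg : averaging_morphism f g psi.

Lemma averaging_morphism_linear : alg_linear psi.
Proof. by have [psiZ _] := psi_avg => a x y; rewrite rmorphD psiZ. Qed.

Lemma averaging_morphism_bracket (x y : A) :
  psi (avg_bracket f x y) = avg_bracket g (psi x) (psi y).
Proof.
have [_ psif] := psi_avg; have psiE z : psi (f z) = g (psi z) := psif z.
by rewrite /avg_bracket rmorphB !rmorphM !psiE.
Qed.

Lemma range_averaging_subalgebra : averaging_subalgebra g (range psi).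
Proof.
have psi_lin := averaging_morphism_linear; have [_ psif] := psi_avg.
split.
- by exists 1; rewrite ?rmorph1.
- by move=> a _ _ [x _ <-] [y _ <-]; exists (a *:: x + y).
- by move=> _ _ [x _ <-] [y _ <-]; exists (x * y); rewrite ?rmorphM.
- by move=> _ [x _ <-]; exists (f x) => //; apply: psif.
Qed.

(** The range of [psi] is an averaging subalgebra containing [S], so generation forces it to be
    everything. *)
Lemma averaging_generates_surjective (S : set B) :
  averaging_generates g S -> S `<=` range psi -> forall b, exists a, psi a = b.
Proof.
move=> gen Spsi b; have: range psi b.
  by rewrite (gen _ range_averaging_subalgebra Spsi).
by case=> a _ <-; exists a.
Qed.

End AveragingMorphism.

Section MonomialMap.
Context {R : comPzRingType} {K : conomType} {B : comPzAlgType R} (h : K -> B).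

(** The linear extension of [h] from the basis of monomials to the monoid algebra. *)
Definition monomial_ext (p : monAlg R K) : B :=
  \sum_(k <- msupp p) p@_k *:: h k.

Lemma monomial_extEw (d : {fset K}) (p : monAlg R K) :
  (msupp p `<=` d)%fset -> monomial_ext p = \sum_(k <- d) p@_k *:: h k.
Proof.
move=> le_d; apply: big_fset_incl => // k _ /mcoeff_outdom ->.
by rewrite ascale0.
Qed.

Lemma monomial_ext_linear : alg_linear monomial_ext.
Proof.
move=> c p q; pose d := (msupp p `|` msupp q `|` msupp (c *:: p + q))%fset.
rewrite (@monomial_extEw d p) ?(@monomial_extEw d q) ?(@monomial_extEw d (c *:: p + q)).
- rewrite ascale_sumr -big_split /=; apply: eq_bigr => k _.
  by rewrite mcoeffD pscaleE ascaleDl ascaleA.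
- by rewrite fsubsetUr.
- by rewrite /d -fsetUA fsetUCA fsubsetUl.
- by rewrite /d -fsetUA fsubsetUl.
Qed.

Lemma monomial_ext_monom k : monomial_ext (pmonom R k) = h k.
Proof.
by rewrite [pmonom]pmonom.unlock (monomial_extEw _ _ msuppU_le) big_seq_fset1 mcoeffUU ascale1.
Qed.

End MonomialMap.

Section FreeKernel.
Context {R : comPzRingType} {X : choiceType}.
Implicit Types m n : {cmonom avg_vars X}.

Lemma monom_opE m u :
  monom_op m (inr u) = ((monom_X m == u) + m (inr u))%N.
Proof. by rewrite /monom_op cmM cmU monom_YE. Qed.

Lemma monom_op_eq m n : monom_op m = monom_op n -> m <> n ->
  exists m1 n1, m = mmul m1 (monom_op n1) /\ n = mmul n1 (monom_op m1).
Proof.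
move=> op_mn neq_mn.
have opE u : ((monom_X m == u) + m (inr u) = (monom_X n == u) + n (inr u))%N.
  by rewrite -!monom_opE op_mn.
(* With equal parts in [X], [opE] would cancel to equal exponents on [Y], hence [m = n]. *)
have neqX : monom_X m != monom_X n.
  apply/negP => /eqP eqX; apply: neq_mn; apply/eqP/cmP => -[x|u].
    by rewrite -!monom_XE eqX.
  by have := opE u; rewrite eqX => /addnI.
(* For [m = u v] and [n = u' v'], [m1] is [u], and [n1] is [n] with one factor [y_u] removed, that
   is [u' w]. *)
pose m1 : {cmonom avg_vars X} :=
  [cmonom if i is inl _ then m i else 0 | i in finsupp m]%M.
pose n1 : {cmonom avg_vars X} :=
  [cmonom (n i - (i == inr (monom_X m)))%N | i in finsupp n]%M.
have m1E i : m1 i = if i is inl _ then m i else 0%N.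
  rewrite cmE fsfun_fun; case: ifP => // /negbT.
  by rewrite -cmE_eq0 => /eqP ->; case: i.
have n1E i : n1 i = (n i - (i == inr (monom_X m)))%N.
  rewrite cmE fsfun_fun; case: ifP => // /negbT.
  by rewrite -cmE_eq0 => /eqP ->.
have X1 : monom_X m1 = monom_X m.
  by apply/eqP/cmP => x; rewrite !monom_XE m1E.
have Y1 : monom_X n1 = monom_X n.
  by apply/eqP/cmP => x; rewrite !monom_XE n1E subn0.
have inrE u : ((inr u : avg_vars X) == inr (monom_X m)) = (monom_X m == u).
  by rewrite eq_sym.
(* The truncated subtraction in [n1] loses nothing: by [opE] and [neqX], [y_u] occurs in [n] once
   more than in [m]. *)
have le_n u : (monom_X m == u <= n (inr u))%N.
  have := opE u; case: eqP => // <-.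
  by rewrite eq_sym (negPf neqX) add0n => <-.
exists m1, n1; split; apply/eqP/cmP => -[x|u]; rewrite cmM ?monom_opX ?addn0.
- by rewrite m1E.
- by rewrite monom_opE Y1 m1E n1E inrE add0n addnBA // -opE addKn.
- by rewrite n1E subn0.
- by rewrite monom_opE X1 m1E n1E inrE addn0 subnK.
Qed.

Lemma pmonomB_bracket m n : monom_op m = monom_op n ->
  exists x y : freeAvg R X,
    avg_bracket (@freeAvg_op R X) x y = pmonom R m - pmonom R n.
Proof.
move=> op_mn; have [->|/eqP neq_mn] := eqVneq m n.
  by exists 0, 0; rewrite /avg_bracket !subrr.
have [m1 [n1 [-> ->]]] := monom_op_eq _ _ op_mn neq_mn.
exists (pmonom R m1), (pmonom R n1).
by rewrite /avg_bracket !freeAvg_op_monom !pmonomM.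
Qed.

(** Replacing each monomial of [p] by a chosen representative of its fibre under [monom_op] gives a
    linear function of [freeAvg_op p], hence 0 on the kernel. Subtracting it writes [p] as a
    combination of differences within fibres, which are brackets. *)
Lemma kernel_freeAvg_op :
  kernel (@freeAvg_op R X) = avg_commutator (@freeAvg_op R X).
Proof.
apply/seteqP; split; last exact: avg_commutator_sub_kernel (freeAvg_op_avg R X).
move=> p p0.
(* Only the values of [r] on the image of [monom_op] matter; the default [k] serves empty fibres. *)
pose r k := xget k [set m : {cmonom avg_vars X} | monom_op m = k].
have rP m : monom_op (r (monom_op m)) = monom_op m.
  by apply: (@xgetPex _ _ [set n | monom_op n = monom_op m]); exists m.
pose G := monomial_ext (fun k => pmonom R (r k)).
have G_lin : alg_linear G by apply: monomial_ext_linear.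
have Gp : \sum_(m <- msupp p) p@_m *:: pmonom R (r (monom_op m)) = 0 :> freeAvg R X.
  rewrite -[RHS](alg_linear0 G_lin) -[X in _ = G X]p0 (alg_linear_sum G_lin).
  by apply: eq_bigr => m _; rewrite (alg_linearZ G_lin) /G monomial_ext_monom.
have -> : p = \sum_(m <- msupp p)
    p@_m *:: (pmonom R m - pmonom R (r (monom_op m)) : freeAvg R X).
  rewrite -[RHS]addr0 -[X in _ = _ + X]Gp -big_split [LHS]pmonomE.
  by apply: eq_bigr => m _; rewrite /= -ascaleDr subrK.
apply: alg_span_sum => m.
have [x [y <-]] := pmonomB_bracket m (r (monom_op m)) (esym (rP m)).
by exists x => //; exists y.
Qed.

End FreeKernel.

Theorem proposition5p11 (R : comPzRingType) (A : comPzAlgType R)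
    (f : A -> A) (f_avg : averaging_operator f)
    (J : choiceType) (s : J -> A) (s_gen : averaging_generates f (range s))
    (phi : {rmorphism freeAvg R J -> A})
    (phi_avg : averaging_morphism (@freeAvg_op R J) f phi)
    (phi_eta : forall j : J, phi (freeAvg_var R j) = s j) :
  [<-> kernel f = avg_commutator f;
       phi @^-1` kernel f =
         [set u + v | u in kernel (@freeAvg_op R J) & v in kernel phi];
       kernel phi `&` range (@freeAvg_op R J) = @freeAvg_op R J @` kernel phi].
Proof.
have F_lin := @freeAvg_op_is_linear R J.
have phi_lin := averaging_morphism_linear phi_avg.
have phiF p : phi (@freeAvg_op R J p) = f (phi p) by case: phi_avg => _; apply.
have f0 := alg_linear0 (proj1 f_avg).
have phi_surj : forall a, exists p, phi p = a.
  apply: (averaging_generates_surjective phi_avg _ s_gen) => _ [j _ <-].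
  by exists (freeAvg_var R j).
tfae.
(* (i) to (ii): if [phi p] lies in the kernel of [f], it is a combination of brackets and lifts to
   such a combination [q] in the free algebra; then [p = q + (p - q)]. *)
- move=> kerf; apply/seteqP; split=> [p /= | _ [u u0 [v v0 <-]]]; last first.
    by rewrite /kernel /= rmorphD v0 addr0 -phiF u0 rmorph0.
  rewrite kerf => /(alg_span_lift _ [set avg_bracket (@freeAvg_op R J) x y
    | x in [set: freeAvg R J] & y in [set: freeAvg R J]] _ _ phi_lin).
  case=> [_ [a _ [b _ <-]] | q q_com phi_q].
    have [[x <-] [y <-]] := (phi_surj a, phi_surj b).
    exists (avg_bracket (@freeAvg_op R J) x y); last exact: averaging_morphism_bracket.
    by exists x => //; exists y.
  exists q; first by rewrite kernel_freeAvg_op.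
  by exists (p - q); rewrite ?subrKC // /kernel /= rmorphB phi_q subrr.
(* (ii) to (iii): if [phi] kills [freeAvg_op q], then [f (phi q) = 0], so [q = u + v] as in (ii),
   and [freeAvg_op] sends [q] and [v] to the same element. *)
- move=> ker_pre; apply/seteqP; split=> [p [/= p0 [q _ q_p]] | _ [v v0 <-]].
    have : (phi @^-1` kernel f) q by rewrite /kernel /= -phiF q_p.
    rewrite ker_pre => -[u u0 [v v0 uv]]; exists v => //.
    by rewrite -q_p -uv (alg_linearD F_lin) u0 add0r.
  by split; [rewrite /kernel /= phiF v0 f0 | exists v].
(* (iii) to (i): lift [a] to [q] and correct [q] by some [v] in the kernel of [phi], so that [q - v]
   is killed by [freeAvg_op] and still maps to [a]. It is then a combination of brackets, which
   [phi] sends to brackets. *)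
- move=> ker_im; apply/seteqP; split; last exact: avg_commutator_sub_kernel.
  move=> a a0; have [q phi_q] := phi_surj a.
  have : (kernel phi `&` range (@freeAvg_op R J)) (@freeAvg_op R J q).
    by split; [rewrite /kernel /= phiF phi_q | exists q].
  rewrite ker_im => -[v v0 v_q].
  have : kernel (@freeAvg_op R J) (q - v).
    apply: (addIr (@freeAvg_op R J v)).
    by rewrite -(alg_linearD F_lin) subrK add0r v_q.
  rewrite kernel_freeAvg_op => /(alg_span_image _ _ _ _ phi_lin) qv.
  rewrite -phi_q -[phi q]subr0 -[in X in _ - X]v0 -rmorphB; apply: qv.
  move=> _ [x _ [y _ <-]]; rewrite (averaging_morphism_bracket phi_avg).
  by exists (phi x) => //; exists (phi y).
Qed.
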